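(* Let $G$ be a torsion-free abelian group, let $P$ denote the set of integer primes, and, for each $p\in P$, identify $G^{*p*p}$ with the group $\mathbb{Z}_p^{\Lambda_p}$ for some index set $\Lambda_p$. If $\mathcal{B}$ is any maximal independent subset of $G$, then the values $(\Phi^p(g))_{p\in P,\, g\in\mathcal{B}}$ completely determine $G$.
   Context: $\mathbb{Z}_p$ denotes the $p$-adic integers. For a torsion-free abelian group $G$, $G^{*p}=\mathrm{Hom}(G,\mathbb{Z}_p)$ is the (torsion-free abelian) group of all group homomorphisms $G\to\mathbb{Z}_p$, and $G^{*p*p}=\mathrm{Hom}(G^{*p},\mathbb{Z}_p)$. The homomorphism $\Phi^p:G\to G^{*p*p}$ sends $g$ to $\hat{g}^p$, where $\hat{g}^p(f)=f(g)$ for $f\in G^{*p}$; under the identification of $G^{*p*p}$ with $\mathbb{Z}_p^{\Lambda_p}$ (the group of $\Lambda_p$-tuples of elements of $\mathbb{Z}_p$), $\Phi^p$ sends each element of $G$ to a $\Lambda_p$-tuple. Independence in a torsion-free abelian group means $\mathbb{Z}$-linear independence. *)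

(* Defs.v *)
From HB Require Import structures.
From mathcomp Require Import all_boot all_order all_algebra.
From mathcomp Require Import boolp classical_sets functions.

Set Implicit Arguments.
Unset Strict Implicit.
Unset Printing Implicit Defensive.

Import GRing.Theory.

Local Open Scope classical_set_scope.
Local Open Scope ring_scope.

(** The p-adic integers, as the inverse limit of the groups Z/p^n: the n-th
    component is the canonical representative, in [0, p^n), of the residue
    modulo p^n (that it is canonical is forced by [padic_resP] when p > 0).
    Only the additive group is needed. The group structure makes sense for all
    p, but the type is the p-adic integers only when p is prime. *)
Record padic_int (p : nat) := PadicInt {
  padic_res :> nat -> int;
  padic_resP : forall n, padic_res n = (padic_res n.+1 %% (p ^ n)%N)%Z
}.

Lemma padic_intP p (x y : padic_int p) : (forall n, x n = y n) -> x = y.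
Proof.
case: x y => [x xP] [y yP] /= /funext exy; case: _ / exy yP => yP.
by congr PadicInt; apply: Prop_irrelevance.
Qed.

HB.instance Definition _ p := gen_eqMixin (padic_int p).
HB.instance Definition _ p := gen_choiceMixin (padic_int p).

Section PadicGroup.
Variable p : nat.
Implicit Types x y z : padic_int p.

Lemma modz_expnS (m : int) n :
  ((m %% (p ^ n.+1)%N)%Z %% (p ^ n)%N)%Z = (m %% (p ^ n)%N)%Z.
Proof.
by rewrite [in RHS](divz_eq m (p ^ n.+1)%N) [in RHS]expnS PoszM mulrA modzMDl
  -PoszM -expnS.
Qed.

Lemma padic_res_mod x n : (x n %% (p ^ n)%N)%Z = x n.
Proof. by rewrite padic_resP modz_mod. Qed.

Definition of_residues (u : nat -> int)
    (uP : forall n, (u n = u n.+1 %[mod (p ^ n)%N])%Z) : padic_int p :=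
  PadicInt (fun n => etrans (uP n) (esym (modz_expnS (u n.+1) n))).

Lemma padic_zero_subproof n : (0 = 0 %[mod (p ^ n)%N])%Z.
Proof. by []. Qed.
Definition padic_zero := of_residues padic_zero_subproof.

Lemma padic_add_subproof x y n :
  (x n + y n = x n.+1 + y n.+1 %[mod (p ^ n)%N])%Z.
Proof. by rewrite (padic_resP x) (padic_resP y) modzDm. Qed.
Definition padic_add x y := of_residues (padic_add_subproof x y).

Lemma padic_opp_subproof x n : (- x n = - x n.+1 %[mod (p ^ n)%N])%Z.
Proof. by rewrite (padic_resP x) modzNm. Qed.
Definition padic_opp x := of_residues (padic_opp_subproof x).

Lemma padic_addA : associative padic_add.
Proof. by move=> x y z; apply: padic_intP => n /=; rewrite modzDml modzDmr addrA. Qed.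

Lemma padic_addC : commutative padic_add.
Proof. by move=> x y; apply: padic_intP => n /=; rewrite addrC. Qed.

Lemma padic_add0 : left_id padic_zero padic_add.
Proof. by move=> x; apply: padic_intP => n /=; rewrite mod0z add0r padic_res_mod. Qed.

Lemma padic_addN : left_inverse padic_zero padic_opp padic_add.
Proof. by move=> x; apply: padic_intP => n /=; rewrite modzDml addNr. Qed.

HB.instance Definition _ := GRing.isZmodule.Build (padic_int p)
  padic_addA padic_addC padic_add0 padic_addN.

End PadicGroup.

(** Hom(U, V) is an abelian group under pointwise addition. *)
Section HomGroup.
Variables U V : zmodType.

HB.instance Definition _ := gen_eqMixin {additive U -> V}.
HB.instance Definition _ := gen_choiceMixin {additive U -> V}.

Implicit Types f g h : {additive U -> V}.

Lemma additiveP f g : (forall x, f x = g x) -> f = g.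
Proof.
case: f g => [f [[fP]]] [g [[gP]]] /= /funext efg.
case: _ / efg gP => gP.
by rewrite (Prop_irrelevance gP fP).
Qed.

Definition hom_zero : {additive U -> V} := \0.
Definition hom_add f g : {additive U -> V} := f \+ g.
Definition hom_opp f : {additive U -> V} := \- f.

Lemma hom_addA : associative hom_add.
Proof. by move=> f g h; apply: additiveP => x /=; rewrite addrA. Qed.

Lemma hom_addC : commutative hom_add.
Proof. by move=> f g; apply: additiveP => x /=; rewrite addrC. Qed.

Lemma hom_add0 : left_id hom_zero hom_add.
Proof. by move=> f; apply: additiveP => x /=; rewrite add0r. Qed.

Lemma hom_addN : left_inverse hom_zero hom_opp hom_add.
Proof. by move=> f; apply: additiveP => x /=; rewrite addNr. Qed.

HB.instance Definition _ := GRing.isZmodule.Build {additive U -> V}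
  hom_addA hom_addC hom_add0 hom_addN.

End HomGroup.

Definition pdual (p : nat) (G : zmodType) : zmodType :=
  {additive G -> padic_int p}.

Section Evaluation.
Variables (p : nat) (G : zmodType).

Definition peval (g : G) (f : pdual p G) : padic_int p := f g.

Lemma peval_is_zmod_morphism g : zmod_morphism (peval g).
Proof. by []. Qed.

HB.instance Definition _ g :=
  GRing.isZmodMorphism.Build (pdual p G) (padic_int p) (peval g)
    (peval_is_zmod_morphism g).

Definition Phi (g : G) : pdual p (pdual p G) := peval g.

Lemma Phi_is_zmod_morphism : zmod_morphism Phi.
Proof. by move=> g h; apply: additiveP => f /=; rewrite /peval raddfB. Qed.

HB.instance Definition _ :=
  GRing.isZmodMorphism.Build G (pdual p (pdual p G)) Phi Phi_is_zmod_morphism.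

End Evaluation.

Definition torsion_free (G : zmodType) :=
  forall (n : nat) (g : G), (0 < n)%N -> g *+ n = 0 -> g = 0.

Definition independent (G : zmodType) (B : set G) :=
  forall (s : seq G) (c : G -> int), uniq s -> (forall g, g \in s -> B g) ->
    \sum_(g <- s) g *~ c g = 0 -> forall g, g \in s -> c g = 0.

Definition maximal_independent (G : zmodType) (B : set G) :=
  independent B /\ forall C : set G, independent C -> B `<=` C -> C = B.

(* Main.v *)
(** Call x in G and y in H commensurate if some positive multiple of (x, y)
    lies in the subgroup of G x H generated by the pairs (b, beta b). Linear
    independence of B and C = beta(B) makes this relation functional in both
    directions; everything is in proving it total. Some multiple n x lies in
    the span of B, hence is commensurate to some y, so it suffices to divide y
    by each prime p dividing n. Commensurate elements have corresponding images
    in the double p-duals, because these are torsion-free, so Phi y is divisible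
    by p, i.e. all f : H -> Z_p map y into p Z_p.

    This forces y into p H. Otherwise take a p-pure subgroup A of H maximal for
    the property that y is not in A + p H. By maximality H = Z y + A + p H, so
    that H / (A + p^n H) is cyclic of order p^n, generated by y, for all n;
    reading off the coefficient of y gives f : H -> Z_p with f y = 1. *)

Require Import Defs.
From HB Require Import structures.
From mathcomp Require Import all_boot all_order all_algebra.
From mathcomp Require Import boolp classical_sets functions.

Set Implicit Arguments.
Unset Strict Implicit.

Import GRing.Theory.
Local Open Scope classical_set_scope.
Local Open Scope ring_scope.

(** * Bezout relations modulo a prime, and residues of p-adic sums *)

Lemma prime_bezoutz (p : nat) (k : int) :
  prime p -> ~~ (p %| k)%Z -> exists u v : int, u * k + v * p%:Z = 1.
Proof.
move=> p_pr pNk; have [u [v uv]] := Bezoutz k p%:Z.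
exists u, v; rewrite uv; apply/eqP; change (coprimez k p%:Z).
by rewrite coprimezE coprime_sym prime_coprime.
Qed.

Lemma subrACA (V : zmodType) (x y z t : V) :
  x - y - (z - t) = x - z - (y - t).
Proof. by rewrite [in LHS]opprD addrACA -opprD. Qed.

Section PadicResidues.
Variable p : nat.
Implicit Types x y : padic_int p.

Lemma padic_resD x y n : (x + y) n = ((x n + y n) %% (p ^ n)%N)%Z.
Proof. by []. Qed.

Lemma padic_resN x n : (- x) n = ((- x n) %% (p ^ n)%N)%Z.
Proof. by []. Qed.

Lemma padic_resMn x m n : (x *+ m) n = ((x n *+ m) %% (p ^ n)%N)%Z.
Proof.
elim: m => [|m IHm]; first by rewrite !mulr0n.
by rewrite !mulrS padic_resD IHm modzDmr.
Qed.

End PadicResidues.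

(** Membership of 0 is left out so that the empty set, the union of the empty chain, qualifies in
    Zorn's lemma. *)
Definition avoiding_pure (p : nat) (G : zmodType) (g : G) (A : set G) :=
  [/\ forall x y, A x -> A y -> A (x - y),
      forall x, A (x *~ p%:Z) -> A x & forall h, ~ A (g - h *~ p%:Z)].

(** * A p-adic functional with residue 1 at [g] *)

Section Hyperplane.
Variables (p : nat) (p_pr : prime p) (G : zmodType) (g : G).
Variables (A : set G) (A_pure : avoiding_pure p g A) (A0 : A 0).

Let AB : forall x y, A x -> A y -> A (x - y).
Proof. by case: A_pure. Qed.
Let A_divp : forall x, A (x *~ p%:Z) -> A x.
Proof. by case: A_pure. Qed.
Let AgNp : forall h, ~ A (g - h *~ p%:Z).
Proof. by case: A_pure. Qed.
Let AN x : A x -> A (- x).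
Proof. by rewrite -sub0r; apply: AB. Qed.
Let AD x y : A x -> A y -> A (x + y).
Proof. by move=> Ax Ay; rewrite -[y]opprK; apply/AB/AN. Qed.
Let AZ x (k : int) : A x -> A (x *~ k).
Proof.
move=> Ax; have AX n : A (x *+ n).
  by elim: n => [|n IHn]; rewrite ?mulr0n // mulrS; apply: AD.
by case: k => n; [exact: AX | rewrite NegzE mulrNz; apply/AN/AX].
Qed.

Hypothesis A_max : forall M : set G, A `<` M -> ~ avoiding_pure p g M.

(** Otherwise [M], the subgroup generated by [A] and [x], contradicts the maximality of [A]. *)
Lemma spanning_modp x : exists (c : int) (h : G), A (x - (g *~ c + h *~ p%:Z)).
Proof.
apply: contrapT => NAx; have {}NAx c h : ~ A (x - (g *~ c + h *~ p%:Z)).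
  by move=> Ax; apply: NAx; exists c, h.
pose M := [set y | exists k : int, A (y - x *~ k)].
apply: (A_max (M := M)).
  split=> [y Ay|sMA]; first by exists 0; rewrite mulr0z subr0.
  by apply: (NAx 0 0); rewrite mulr0z mul0rz addr0 subr0; apply: sMA;
    exists 1; rewrite mulr1z subrr.
split=> [y z [k Ak] [l Al] | y [k Ak] | h [k Ak]].
- by exists (k - l); rewrite mulrzBr subrACA; apply: AB.
- have [/dvdzP[k' def_k] | pNk] := boolP (p %| k)%Z.
    by exists k'; apply: A_divp; rewrite mulrzBl -mulrzA -def_k.
  have [u [v uv]] := prime_bezoutz p_pr pNk.
  (* Modulo [A], k x = p y, hence x = u k x + v p x = p (u y + v x). *)
  case: (NAx 0 (y *~ u + x *~ v)).
  rewrite mulr0z add0r -{1}[x]mulr1z -uv mulrzDr mulrzDl -!mulrzA.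
  rewrite opprD addrACA subrr addr0 [u * p%:Z]mulrC [u * k]mulrC !mulrzA.
  by rewrite -mulrzBl; apply: AZ; rewrite -opprB; apply: AN.
have [/dvdzP[k' def_k] | pNk] := boolP (p %| k)%Z.
  apply: (AgNp (h := h + x *~ k')).
  by rewrite mulrzDl -mulrzA -def_k opprD addrA.
have [u [v uv]] := prime_bezoutz p_pr pNk.
(* Modulo [A], k x = g - p h, hence x = u k x + v p x = u g + p (v x - u h). *)
case: (NAx u (x *~ v - h *~ u)).
suff ->: x - (g *~ u + (x *~ v - h *~ u) *~ p%:Z) =
         - ((g - h *~ p%:Z - x *~ k) *~ u) by apply/AN/AZ.
rewrite !mulrzBl -!mulrzA -{1}[x]mulr1z -uv mulrzDr [u * p%:Z]mulrC.
by rewrite [k * u]mulrC opprB [in LHS]addrCA opprD addrA addrK.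
Qed.

Let coord n x (c : int) := exists h, A (x - (g *~ c + h *~ (p ^ n)%N%:Z)).

(** Expanding the remainder [h] by [spanning_modp] corrects the coefficient by a multiple of p^n. *)
Lemma coord_exists n x : exists c, coord n x c.
Proof.
elim: n => [|n [c [h Ah]]].
  by exists 0, x; rewrite mulr0z add0r mulr1z subrr.
have [d [k Ak]] := spanning_modp h.
exists (c + d * (p ^ n)%N%:Z), k.
have := AD Ah (AZ (p ^ n)%N%:Z Ak).
rewrite mulrzBl addrA opprD addrA subrK -addrA -opprD.
by rewrite mulrzDl -!mulrzA addrA -mulrzDr -PoszM -expnS.
Qed.

Lemma coordB n x y c d : coord n x c -> coord n y d -> coord n (x - y) (c - d).
Proof.
move=> [h Ah] [k Ak]; exists (h - k).
have := AB Ah Ak.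
by rewrite subrACA; congr (A (_ - _)); rewrite mulrzBr mulrzBl opprD addrACA.
Qed.

(** If [p] did not divide [c], Bezout would put [g] in A + p G. If it does, p-purity cancels one
    factor [p] from the relation. *)
Lemma coord0 n c : coord n 0 c -> ((p ^ n)%N %| c)%Z.
Proof.
elim: n c => [|n IHn] c [h]; first by rewrite dvd1z.
rewrite sub0r => /AN; rewrite opprK expnS PoszM => Ah.
have [/dvdzP[k def_k] | pNc] := boolP (p %| c)%Z.
  rewrite def_k mulrC; apply: dvdz_mul => //; apply: IHn.
  exists h; rewrite sub0r; apply/AN/A_divp.
  by rewrite mulrzDl -!mulrzA -def_k [_ * p%:Z]mulrC.
have [u [v uv]] := prime_bezoutz p_pr pNc.
case: (AgNp (h := g *~ v - h *~ ((p ^ n)%N%:Z * u))).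
have := AZ u Ah; congr (A _).
rewrite -[X in _ = X - _](mulr1z g) -uv mulrzDr mulrzBl mulrzDl -!mulrzA opprB.
rewrite -[in RHS]addrA (addrC (g *~ (v * p%:Z))) subrK [u * c]mulrC.
by rewrite -mulrA [p%:Z * _]mulrC.
Qed.

Lemma coord_uniq n x c d : coord n x c -> coord n x d ->
  (c = d %[mod (p ^ n)%N])%Z.
Proof.
move=> xc xd; apply/eqP; rewrite eqz_mod_dvd.
by apply: coord0; rewrite -(subrr x); apply: coordB.
Qed.

Lemma coordS n x c : coord n.+1 x c -> coord n x c.
Proof.
by move=> [h Ah]; exists (h *~ p%:Z); rewrite -mulrzA -PoszM -expnS.
Qed.

Lemma exists_functional_of_hyperplane : exists f : pdual p G, f g 1%N = 1.
Proof.
have /(choice)[c cP] (nx : nat * G) := coord_exists nx.1 nx.2.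
have fP x n : (c (n, x) = c (n.+1, x) %[mod (p ^ n)%N])%Z.
  by apply: (coord_uniq (x := x)); [apply: (cP (n, x)) |
    apply/coordS/(cP (n.+1, x))].
pose f x : padic_int p := of_residues (fP x).
have fB : zmod_morphism f.
  move=> x y; apply: padic_intP => n.
  rewrite padic_resD padic_resN /= modzNm modzDm.
  by apply/(coord_uniq (x := x - y))/coordB; apply: (cP (n, _)).
pose fM := GRing.isZmodMorphism.Build G (padic_int p) f fB.
pose fA : {additive G -> padic_int p} := HB.pack f fM.
exists fA => /=; rewrite -(modz_small (m := 1) (d := (p ^ 1)%N)).
  apply: (coord_uniq (x := g)); first exact: (cP (1%N, g)).
  by exists 0; rewrite mulr1z mul0rz addr0 subrr.
by rewrite expn1 /= ltz_nat prime_gt1.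
Qed.

End Hyperplane.
Lemma exists_functional (p : nat) (G : zmodType) (g : G) :
  prime p -> torsion_free G -> (forall h, g <> h *+ p) ->
  exists f : pdual p G, f g 1%N = 1.
Proof.
move=> p_pr tfG gNp.
have [F sFP totF|A [A_pure A_max]] := @Zorn_bigcup G (avoiding_pure p g).
  split=> [x y [X FX Xx] [Y FY Yy] | x [X FX Xx] | h [X FX Xgh]].
  - have [sXY|sYX] := totF _ _ FX FY.
      by exists Y => //; case: (sFP _ FY) => YB _ _; apply: YB => //; apply: sXY.
    by exists X => //; case: (sFP _ FX) => XB _ _; apply: XB => //; apply: sYX.
  - by exists X => //; case: (sFP _ FX) => _ Xdivp _; apply: Xdivp.
  by case: (sFP _ FX) => _ _ /(_ h).
apply: (exists_functional_of_hyperplane p_pr A_pure _ A_max).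
(* Without 0, [A] is empty and {0} is larger: it is p-pure as [G] is torsion-free, and it avoids [g]
   as [g] is not divisible by [p]. *)
apply: contrapT => NA0; apply: (A_max [set 0]).
  split=> [x Ax|s0A]; first by case: NA0; case: A_pure => + _ _;
    rewrite -(subrr x); apply.
  exact/NA0/s0A.
split=> [x y -> ->|x xp0|h /eqP]; first by rewrite /= subr0.
  exact: tfG (prime_gt0 p_pr) xp0.
by rewrite subr_eq0 => /eqP; apply: gNp.
Qed.

(** * Torsion-freeness of p-adic duals *)

Lemma padic_int_torsion_free (p : nat) : prime p -> torsion_free (padic_int p).
Proof.
move=> p_pr n x n_gt0 nx0; apply: padic_intP => k.
(* With n = m p^a, the vanishing of n x at level k + a makes p^k divide that residue of [x], which
   reduces to [x k]. *)
have [m co_pm def_n] := pfactor_coprime p_pr n_gt0.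
set a := logn p n in def_n.
have res_mod i j : (x (i + j)%N %% (p ^ i)%N)%Z = x i.
  elim: j => [|j <-]; first by rewrite addn0 padic_res_mod.
  rewrite addnS [in RHS](padic_resP x (i + j)).
  rewrite [X in (X %% _)%Z = _](divz_eq _ (p ^ (i + j))%N).
  by rewrite {2}expnD PoszM [_%:Z * _%:Z]mulrC mulrA modzMDl.
have res0 i : (0 : padic_int p) i = 0 by rewrite /= mod0z.
rewrite res0 -(res_mod k a); apply/dvdz_mod0P; rewrite dvdzE /=.
have: ((p ^ (k + a))%N %| x (k + a)%N *+ n)%Z.
  by apply/dvdz_mod0P; rewrite -padic_resMn nx0 res0.
rewrite -mulr_natr natz dvdzE abszM /= def_n expnD mulnA.
by rewrite dvdn_pmul2r ?expn_gt0 ?prime_gt0 // Gauss_dvdl // coprimeXl.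
Qed.

Lemma hom_mulrn (U V : zmodType) (f : {additive U -> V}) n x :
  (f *+ n) x = f x *+ n.
Proof. by elim: n => [|n IHn]; rewrite ?mulr0n // !mulrS /= -IHn. Qed.

Lemma pdual_torsion_free (p : nat) (U : zmodType) :
  prime p -> torsion_free (pdual p U).
Proof.
move=> p_pr n f n_gt0 nf0; apply: additiveP => x.
by apply: (padic_int_torsion_free p_pr n_gt0); rewrite -hom_mulrn nf0.
Qed.

Lemma torsion_free_inj (U : zmodType) (n : nat) (x y : U) :
  torsion_free U -> (0 < n)%N -> x *+ n = y *+ n -> x = y.
Proof.
move=> tfU n_gt0 nxy; apply/eqP; rewrite -subr_eq0.
by apply/eqP/(tfU n) => //; rewrite mulrnBl nxy subrr.
Qed.

(** * The commensurability relation *)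

Section Correspondence.
Variables (I : eqType) (J : set I).

(** Families rather than subsets let both groups share one index set: [B], with the families [id]
    and [beta]. *)
Definition family_independent (U : zmodType) (F : I -> U) :=
  forall (s : seq I) (c : I -> int), uniq s -> (forall i, i \in s -> J i) ->
    \sum_(i <- s) F i *~ c i = 0 -> forall i, i \in s -> c i = 0.

Definition family_spanning (U : zmodType) (F : I -> U) :=
  forall x, exists (n : nat) (s : seq (I * int)), [/\ (0 < n)%N,
    forall a, a \in s -> J a.1 & x *+ n = \sum_(a <- s) F a.1 *~ a.2].

(* The pairs [(x, y)] some positive multiple of which lies in the subgroup
   generated by the pairs [(F i, F' i)] for [i] in [J]. *)
Definition commensurate (U V : zmodType) (F : I -> U) (F' : I -> V) x y :=
  exists (n : nat) (s : seq (I * int)), [/\ (0 < n)%N,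
    forall a, a \in s -> J a.1,
    x *+ n = \sum_(a <- s) F a.1 *~ a.2 &
    y *+ n = \sum_(a <- s) F' a.1 *~ a.2].

(** Merges repeated indices, since independence speaks of duplicate-free lists. *)
Lemma sum_collect (U : zmodType) (F : I -> U) (s : seq (I * int)) :
  \sum_(a <- s) F a.1 *~ a.2 =
  \sum_(i <- undup (map fst s)) F i *~ \sum_(a <- s | a.1 == i) a.2.
Proof.
under [RHS]eq_bigr do rewrite mulrz_sumr big_mkcond.
rewrite exchange_big /= big_seq [RHS]big_seq; apply: eq_bigr => a sa.
rewrite -big_mkcond /= -big_filter (perm_big [:: a.1]) ?big_seq1 //.
apply: uniq_perm => [||i] //; first by rewrite filter_uniq ?undup_uniq.
rewrite mem_filter mem_undup inE eq_sym.
by have [->|//] := eqVneq; rewrite map_f.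
Qed.

Variables (U V : zmodType) (F : I -> U) (F' : I -> V).

Lemma commensurateC x y : commensurate F F' x y -> commensurate F' F y x.
Proof. by move=> [n [s [n_gt0 sJ xE yE]]]; exists n, s. Qed.

Lemma commensurate_gen i : J i -> commensurate F F' (F i) (F' i).
Proof.
move=> Ji; exists 1%N, [:: (i, 1)]; rewrite !big_seq1 /= !mulr1n !mulr1z.
by split=> // a; rewrite inE => /eqP ->.
Qed.

Lemma commensurateB x y x' y' : commensurate F F' x y ->
  commensurate F F' x' y' -> commensurate F F' (x - x') (y - y').
Proof.
move=> [n [s [n_gt0 sJ xE yE]]] [n' [s' [n'_gt0 s'J xE' yE']]].
pose scale (k : int) (a : I * int) := (a.1, a.2 * k).
(* Common denominator: n n' (x - x') = n' (n x) - n (n' x'). *)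
exists (n * n')%N, (map (scale n'%:Z) s ++ map (scale (- n%:Z)) s').
have sumE (W : zmodType) (E : I -> W) z z' :
    z *+ n = \sum_(a <- s) E a.1 *~ a.2 ->
    z' *+ n' = \sum_(a <- s') E a.1 *~ a.2 ->
    (z - z') *+ (n * n') =
    \sum_(a <- map (scale n'%:Z) s ++ map (scale (- n%:Z)) s') E a.1 *~ a.2.
  move=> zE zE'; rewrite mulrnBl {2}[(n * n')%N]mulnC !mulrnA zE zE'.
  rewrite big_cat !big_map /= !pmulrn !mulrz_suml -sumrN.
  by congr (_ + _); apply: eq_bigr => a _; rewrite mulrzA // mulrNz.
split; [by rewrite muln_gt0 n_gt0 | | exact: sumE | exact: sumE].
move=> a; rewrite mem_cat => /orP[] /mapP[b sb ->] /=; first exact: sJ.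
exact: s'J.
Qed.

Lemma commensurate_mulrnl p x y : (0 < p)%N ->
  commensurate F F' (x *+ p) (y *+ p) -> commensurate F F' x y.
Proof.
move=> p_gt0 [n [s [n_gt0 sJ xE yE]]]; exists (p * n)%N, s.
by rewrite muln_gt0 p_gt0 !mulrnA.
Qed.

Lemma commensurate0 y : torsion_free V -> family_independent F ->
  commensurate F F' 0 y -> y = 0.
Proof.
move=> tfV freeF [n [s [n_gt0 sJ /esym]]]; rewrite mul0rn !sum_collect.
move=> sumF sumF'; apply: (tfV n) => //; rewrite sumF' big_seq big1 // => i si.
rewrite (freeF _ _ (undup_uniq _) _ sumF) ?mulr0z // => j.
by rewrite mem_undup => /mapP[a sa ->]; apply: sJ.
Qed.

Lemma commensurate_inj x y y' : torsion_free V -> family_independent F ->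
  commensurate F F' x y -> commensurate F F' x y' -> y = y'.
Proof.
move=> tfV freeF xy xy'; apply/eqP; rewrite -subr_eq0; apply/eqP.
by apply: commensurate0 => //; rewrite -(subrr x); apply: commensurateB.
Qed.

Section Division.
Hypothesis tfV : torsion_free V.
Variable psi : forall p : nat,
  {additive pdual p (pdual p U) -> pdual p (pdual p V)}.
Hypothesis psi_Phi : forall p i, prime p -> J i ->
  psi p (Phi p (F i)) = Phi p (F' i).

(** Both sides agree after multiplication by [n], which cancels in a torsion-free double dual. *)
Lemma commensurate_Phi p x y : prime p -> commensurate F F' x y ->
  psi p (Phi p x) = Phi p y.
Proof.
move=> p_pr [n [s [n_gt0 sJ xE yE]]].
apply: (torsion_free_inj (pdual_torsion_free p_pr) n_gt0).
rewrite -!raddfMn xE yE !raddf_sum /= big_seq [RHS]big_seq.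
by apply: eq_bigr => a sa; rewrite !raddfMz /= psi_Phi //; apply: sJ.
Qed.

Lemma commensurate_div_prime p x y : prime p ->
  commensurate F F' (x *+ p) y -> exists y', commensurate F F' x y'.
Proof.
move=> p_pr xy; have [[y' yE]|yNp] := pselect (exists y', y = y' *+ p).
  by exists y'; apply: (commensurate_mulrnl (prime_gt0 p_pr)); rewrite -yE.
(* At [f], the image of [Phi p (x *+ p)] is a multiple of [p], whereas [f y] is 1 modulo [p]. *)
have [h yE|f fy1] := exists_functional p_pr tfV (g := y).
  by apply: yNp; exists h.
have Phi_yf := congr1 (fun e : pdual p (pdual p V) => e f)
  (commensurate_Phi p_pr xy).
move: Phi_yf; rewrite /= !raddfMn hom_mulrn /= /peval.
move=> /(congr1 (fun z : padic_int p => z 1%N)).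
by rewrite padic_resMn fy1 expn1 -mulr_natr natz modzMl.
Qed.

Lemma commensurate_div n x y : (0 < n)%N ->
  commensurate F F' (x *+ n) y -> exists y', commensurate F F' x y'.
Proof.
elim/ltn_ind: n x y => n IHn x y n_gt0.
have [n_le1|n_gt1] := leqP n 1.
  have -> : n = 1%N by apply/eqP; rewrite eqn_leq n_le1.
  by exists y.
have p_pr := pdiv_prime n_gt1; rewrite -(divnK (pdiv_dvd n)) mulrnA.
move=> /(commensurate_div_prime p_pr)[y']; apply: IHn.
  by rewrite ltn_Pdiv ?prime_gt1.
by rewrite divn_gt0 ?prime_gt0 // dvdn_leq ?pdiv_dvd.
Qed.

Lemma commensurate_total : family_spanning F ->
  forall x, exists y, commensurate F F' x y.
Proof.
move=> spanF x; have [n [s [n_gt0 sJ xE]]] := spanF x.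
apply: (commensurate_div n_gt0 (y := \sum_(a <- s) F' a.1 *~ a.2)).
by exists 1%N, s.
Qed.

End Division.
End Correspondence.

(** * Spanning by maximal independent sets, and transport between double duals *)

Lemma maximal_independent_spanning (G : zmodType) (B : set G) :
  maximal_independent B -> family_spanning B id.
Proof.
move=> [freeB maxB] x.
have [Bx|NBx] := pselect (B x).
  exists 1%N, [:: (x, 1)]; rewrite big_seq1 mulr1n mulr1z.
  by split=> // a; rewrite inE => /eqP ->.
(* A nontrivial relation over this larger set must involve [x], as [B] is independent; it is then
   solved for a multiple of [x]. *)
have : ~ independent (B `|` [set x]).
  move=> /maxB/(_ (@subsetUl _ _ _)) BxE; apply: NBx.
  by rewrite -BxE; right.
move=> /existsNP[s /existsNP[c /not_implyP[s_uniq /not_implyP[sBx]]]].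
move=> /not_implyP[sum0 /existsNP[g /not_implyP[sg cg]]].
have remB h : h \in rem x s -> B h.
  by rewrite mem_rem_uniq // !inE => /andP[/eqP hx /sBx[]].
have [sx|sNx] := boolP (x \in s); last first.
  case: cg; apply: (freeB s c) => // h sh.
  by apply: remB; rewrite rem_id.
have sumE : x *~ c x = \sum_(h <- rem x s) h *~ - c h.
  move: sum0; rewrite (big_rem x) //= => /eqP; rewrite addr_eq0 => /eqP ->.
  by rewrite -sumrN; apply: eq_bigr => h _; rewrite mulrNz.
have cx : c x <> 0.
  move=> cx0; case: cg; have [->//|gx] := eqVneq g x.
  apply: (freeB (rem x s) c) => //; first exact: rem_uniq.
    apply/eqP; rewrite -oppr_eq0 -sumrN.
    by under eq_bigr do rewrite -mulrNz; rewrite -sumE cx0 mulr0z.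
  by rewrite mem_rem_uniq // !inE gx.
(* The multiplier must be positive, so the sign of [c x] moves into the coefficients. *)
exists `|c x|%N, [seq (h, - c h * sgz (c x)) | h <- rem x s].
rewrite absz_gt0; split; first exact/eqP.
  by move=> a /mapP[h sh ->]; apply: remB.
rewrite big_map /= pmulrn abszEsg mulrC mulrzA sumE mulrz_suml.
by apply: eq_bigr => h _; rewrite mulrzA.
Qed.

Lemma double_dual_transport (U V : zmodType) (L : nat -> zmodType)
    (iotaU : forall p, {additive pdual p (pdual p U) -> L p})
    (iotaV : forall p, {additive pdual p (pdual p V) -> L p}) :
  (forall p : nat, prime p -> bijective (iotaV p)) ->
  exists psi : forall p, {additive pdual p (pdual p U) -> pdual p (pdual p V)},
    forall p u v, prime p -> iotaU p u = iotaV p v -> psi p u = v.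
Proof.
move=> isoV.
suff psi p : {f : {additive pdual p (pdual p U) -> pdual p (pdual p V)} |
    prime p -> forall u v, iotaU p u = iotaV p v -> f u = v}.
  by exists (fun p => sval (psi p)) => p u v p_pr; apply: (svalP (psi p)).
(* The map is [iotaU p] followed by the inverse of [iotaV p], with the zero map as default when [p]
   is not prime. *)
apply: cid; have [/isoV[k iotaK kK]|pNpr] := boolP (prime p); last by exists \0.
have kB : zmod_morphism k := can2_zmod_morphism iotaK kK.
pose kM := GRing.isZmodMorphism.Build _ _ k kB.
pose kA : {additive L p -> pdual p (pdual p V)} := HB.pack k kM.
by exists (kA \o iotaU p) => _ u v /= ->.
Qed.

Unset Implicit Arguments.
(* "The values determine G": if G and H carry maximal independent subsets B and
   C, matched by a bijection beta, and the tuples attached to b in B and to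
   beta b in C agree for every prime p, then beta extends to an isomorphism
   from G onto H. The identifications iotaG and iotaH of the double duals with
   the p-adic integers to the power Lambda p are arbitrary isomorphisms. *)
Theorem proposition5p1
  (G H : zmodType) (tfG : torsion_free G) (tfH : torsion_free H)
  (Lambda : nat -> Type)
  (iotaG : forall p : nat,
     {additive pdual p (pdual p G) -> (Lambda p -> padic_int p)})
  (iotaH : forall p : nat,
     {additive pdual p (pdual p H) -> (Lambda p -> padic_int p)})
  (iotaG_iso : forall p : nat, prime p -> bijective (iotaG p))
  (iotaH_iso : forall p : nat, prime p -> bijective (iotaH p))
  (B : set G) (C : set H)
  (maxB : maximal_independent B) (maxC : maximal_independent C)
  (beta : G -> H) (beta_bij : set_bij B C beta)
  (same_values : forall (p : nat) (b : G), prime p -> B b ->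
     iotaG p (Phi p b) = iotaH p (Phi p (beta b))) :
  exists phi : {additive G -> H},
    bijective phi /\ forall b : G, B b -> phi b = beta b.
Proof.
have subBC := set_bij_homo beta_bij; have injB := set_bij_inj beta_bij.
have surjC := set_bij_surj beta_bij.
(* [gamma] inverts [beta] on [C]; its values elsewhere are arbitrary. *)
have /choice[gamma gammaP] h : exists b, C h -> B b /\ beta b = h.
  have [/surjC[b Bb <-]|NCh] := pselect (C h); first by exists b.
  by exists 0.
have betaK b : B b -> gamma (beta b) = b.
  move=> Bb; have [|Bgb] := gammaP (beta b); first exact: subBC.
  by apply: injB; rewrite inE.
have freeB : family_independent B id := maxB.1.
have freeC : family_independent B beta.
  move=> s c s_uniq sB sum0 i si.
  rewrite -(betaK i (sB _ si)).
  apply: (maxC.1 (map beta s) (c \o gamma)); last exact: map_f.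
  - rewrite map_inj_in_uniq // => a b sa sb.
    by apply: injB; rewrite inE; apply: sB.
  - by move=> h /mapP[b sb ->]; exact/subBC/sB.
  rewrite big_map -[RHS]sum0 big_seq [RHS]big_seq.
  by apply: eq_bigr => b sb /=; rewrite betaK //; apply: sB.
have spanB : family_spanning B id := maximal_independent_spanning maxB.
have spanC : family_spanning B beta.
  move=> y; have [n [s [n_gt0 sC yE]]] := maximal_independent_spanning maxC y.
  exists n, [seq (gamma a.1, a.2) | a <- s]; split=> //.
    by move=> a /mapP[h sh ->] /=; case: (gammaP h.1 (sC _ sh)).
  rewrite yE big_map big_seq [RHS]big_seq; apply: eq_bigr => a sa /=.
  by case: (gammaP a.1 (sC _ sa)) => _ ->.
have [psi psiP] := double_dual_transport iotaG iotaH_iso.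
have [psi' psi'P] := double_dual_transport iotaH iotaG_iso.
have [phi phiP] : {phi : G -> H & forall x, commensurate B id beta x (phi x)}.
  apply: choice; apply: (commensurate_total tfH (psi := psi)) => // p b p_pr Bb.
  by apply: psiP => //; apply: same_values.
have [chi chiP] : {chi : H -> G & forall y, commensurate B beta id y (chi y)}.
  apply: choice; apply: (commensurate_total tfG (psi := psi')) => // p b p_pr Bb.
  by apply: psi'P => //; rewrite same_values.
have phi_uniq x y : commensurate B id beta x y -> phi x = y.
  exact: commensurate_inj.
(* The relation is a subgroup and is functional, so its function is additive. *)
have phiB : zmod_morphism phi.
  by move=> x y; apply/phi_uniq/commensurateB.
pose phiM := GRing.isZmodMorphism.Build G H phi phiB.
pose phiA : {additive G -> H} := HB.pack phi phiM.
exists phiA; split=> [|b Bb]; last exact/phi_uniq/commensurate_gen.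
(* Both composites are identities because the relation is functional in each direction. *)
exists chi => [x | y] /=; last exact/phi_uniq/commensurateC.
by apply: (commensurate_inj tfG freeC) (chiP _) (commensurateC (phiP x)).
Qed.
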